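(* Let $d,N\in\mathbb{N}$ with $d,N\ge 1$, let $X=\{x^1,x^2,\ldots,x^N\}\subseteq\mathbb{R}^d$, let $p\in(0,1)$ be such that $pN\notin\mathbb{Z}$, and let $C\subseteq\mathbb{R}^d$ be a line-free polyhedral convex cone with an interior point $c\in\operatorname{int}C$ such that $c_d\neq 0$. Then the vector linear program $$\min\nolimits_K\ D(w,t)\quad\text{s.t. } (w,t)\in B^+\times\mathbb{R}$$ (defined from $X,p,C,c$ as in the context) has a solution $\bar T$ (a finite set, in the sense defined in the context) which provides the finite representation $$Q^-_{X,C}(p)=\bigcap_{(w,t)\in\bar T}\{z\in\mathbb{R}^d \mid w^{\mathsf T}z\ge t\}.$$
   Context: Positive and negative parts: $y^+=\max\{0,y\}$, $y^-=\max\{0,-y\}$ for $y\in\mathbb{R}$. For $y \in \mathbb{R}$, $\lceil y\rceil$ is the smallest integer not smaller than $y$. Scalar quantile: for real data $a^1,\ldots,a^N$ (counted with multiplicity), the empirical lower quantile is $$q^-_{(a^1,\ldots,a^N)}(p)=\min\{a\in\{a^1,\ldots,a^N\} \mid \#\{i\in\{1,\ldots,N\} \mid a^i\le a\}\ge\lceil Np\rceil\}.$$ For $X=\{x^1,\ldots,x^N\}\subseteq\mathbb{R}^d$ and $w\in\mathbb{R}^d$, write $q^-_{w^{\mathsf T}X}(p)$ for the empirical lower quantile of the data $w^{\mathsf T}x^1,\ldots,w^{\mathsf T}x^N$. Cones: the positive dual cone of $C$ is $C^+=\{w\in\mathbb{R}^d \mid w^{\mathsf T}y\ge 0 \text{ for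 all } y\in C\}$. For the chosen interior point $c$ of $C$, put $B^+=\{w\in C^+ \mid w^{\mathsf T}c=1\}$. A cone is line-free if it contains no line. Cone quantile: the empirical lower $C$-quantile of $X$ is $$Q^-_{X,C}(p)=\bigcap_{w\in B^+}\{z\in\mathbb{R}^d \mid w^{\mathsf T}z\ge q^-_{w^{\mathsf T}X}(p)\}.$$ Vector linear program: for $w\in\mathbb{R}^d$ and $t\in\mathbb{R}$ let $$\phi_{w^{\mathsf T}X,p}(t)=\sum_{i=1}^N\left[p\,(w^{\mathsf T}x^i-t)^+ +(1-p)\,(w^{\mathsf T}x^i-t)^-\right]+(1-p)\sum_{i=1}^N w^{\mathsf T}x^i,$$ and let $$D(w,t)=\left(\tfrac{c_d}{|c_d|}w_1,\ \ldots,\ \tfrac{c_d}{|c_d|}w_{d-1},\ \phi_{w^{\mathsf T}X,p}(t)\right)^{\mathsf T}\in\mathbb{R}^d.$$ The order cone is $K=\{y\in\mathbb{R}^d \mid y_1=\cdots=y_{d-1}=0,\ y_d\ge 0\}$, with order $y^1\le_K y^2$ if and only if $y^2-y^1\in K$. The feasible set is $T=B^+\times\mathbb{R}$ and $D[T]=\{D(w,t) \mid (w,t)\in T\}$. A point $\bar y\in D[T]$ is $K$-minimal if $y\in D[T]$ and $y\le_K\bar y$ imply $y=\bar y$; a feasible point $(w,t)\in T$ is a $K$-minimizer if $D(w,t)$ is $K$-minimal in $D[T]$. A solution to the problem is a finite set $\bar T\subseteq T$ of $K$-minimizers such that $$D[T]+K=\operatorname{conv}D[\bar T]+K,$$ where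 $\operatorname{conv}$ denotes the convex hull. *)

(* Defs.v *)
From HB Require Import structures.
From mathcomp Require Import all_boot all_order all_algebra.
From mathcomp Require Import all_classical all_reals all_analysis.

Set Implicit Arguments.
Unset Strict Implicit.
Unset Printing Implicit Defensive.

Import Order.TTheory GRing.Theory Num.Theory.
Import numFieldNormedType.Exports.

Local Open Scope classical_set_scope.
Local Open Scope ring_scope.

Section ScalarQuantile.
Variable R : realType.

Definition pos_part (y : R) : R := Num.max 0 y.
Definition neg_part (y : R) : R := Num.max 0 (- y).

(* The default value 0 of [xget] is used only when S has no least element. *)
Definition set_min (S : set R) : R := xget 0 [set m | S m /\ lbound S m].

(* The data a^1, ..., a^N are indexed by 'I_N, hence counted with
   multiplicity. *)
Definition lower_quantile (N : nat) (a : 'I_N -> R) (p : R) : R :=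
  set_min [set v | range a v /\
    Num.ceil (N%:R * p) <= (#|[pred i | a i <= v]|)%:Z].

Definition phi (N : nat) (a : 'I_N -> R) (p t : R) : R :=
  \sum_(i < N) (p * pos_part (a i - t) + (1 - p) * neg_part (a i - t))
  + (1 - p) * \sum_(i < N) a i.

End ScalarQuantile.

Section Cones.
Variables (R : realType) (d : nat).
Implicit Types (C : set 'cV[R]_d) (c w z : 'cV[R]_d).

Definition inner w z : R := (w^T *m z) 0 0.

Definition polyhedral C := exists (m : nat) (A : 'M[R]_(m, d)) (b : 'cV[R]_m),
  C = [set y | forall i, b i 0 <= (A *m y) i 0].

Definition is_cone C := forall (s : R) y, 0 <= s -> C y -> C (s *: y).

Definition polyhedral_convex_cone C :=
  [/\ polyhedral C, @convex_set R 'cV[R]_d C & is_cone C].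

Definition line_free C :=
  ~ exists a v : 'cV[R]_d, v != 0 /\ forall s : R, C (a + s *: v).

Definition dual_cone C : set 'cV[R]_d :=
  [set w | forall y, C y -> 0 <= inner w y].

Definition Bplus C c : set 'cV[R]_d := dual_cone C `&` [set w | inner w c = 1].

Definition cone_quantile (N : nat) (x : 'I_N -> 'cV[R]_d) C c (p : R) :
    set 'cV[R]_d :=
  \bigcap_(w in Bplus C c)
    [set z | lower_quantile (fun i => inner w (x i)) p <= inner w z].

End Cones.

Section VectorOptimization.
Variables (R : realType) (V : lmodType R) (U : Type).
Implicit Types (K A B S : set V) (f : U -> V) (T : set U).

Definition minkowski_sum A B : set V := [set a + b | a in A & b in B].

Definition conv_hull S : set V := smallest (@convex_set R V) S.

Definition cone_le K (y1 y2 : V) := K (y2 - y1).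

Definition minimal K S (y0 : V) :=
  S y0 /\ forall y, S y -> cone_le K y y0 -> y = y0.

Definition minimizer K f T (u : U) := T u /\ minimal K (f @` T) (f u).

Definition solution K f T (T0 : set U) :=
  [/\ finite_set T0, T0 `<=` T, (forall u, T0 u -> minimizer K f T u) &
      minkowski_sum (f @` T) K = minkowski_sum (conv_hull (f @` T0)) K].

End VectorOptimization.

(* The ambient dimension is d.+1 >= 1; its last coordinate, the d-th one on
   paper, has index [ord_max]. *)
Section QuantileProgram.
Variables (R : realType) (d : nat).

Definition last_axis_cone : set 'cV[R]_d.+1 :=
  [set y | (forall i, i != ord_max -> y i 0 = 0) /\ 0 <= y ord_max 0].

Definition objective (N : nat) (x : 'I_N -> 'cV[R]_d.+1) (p : R)
    (c : 'cV[R]_d.+1) (wt : 'cV[R]_d.+1 * R) : 'cV[R]_d.+1 :=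
  \col_i (if i == ord_max then phi (fun j => inner wt.1 (x j)) p wt.2
          else c ord_max 0 / `|c ord_max 0| * wt.1 i 0).

Definition feasible (C : set 'cV[R]_d.+1) (c : 'cV[R]_d.+1) :
    set ('cV[R]_d.+1 * R) := Bplus C c `*` [set: R].

End QuantileProgram.

(* Main.v *)
Require Import Defs.
From mathcomp Require Import all_boot all_order all_algebra.
From mathcomp Require Import all_classical all_reals all_analysis.
From mathcomp Require Import lra ring.
Set Implicit Arguments.
Unset Strict Implicit.
Unset Printing Implicit Defensive.

Import Order.TTheory GRing.Theory Num.Theory.
Import numFieldNormedType.Exports.
Local Open Scope classical_set_scope.
Local Open Scope ring_scope.

(** The epigraph of the objective is a polyhedral convex cone. Write F w t for the
    objective phi of the projected data inner w (x i), and q w for their lower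
    quantile.

    Rewriting phi as a sum of maxima of two linear functions of (w, t)
    (phiE) shows that F is sublinear and that its epigraph over the dual cone
    of C is cut out by finitely many linear inequalities. For fixed w, the
    slope of F w to the left and to the right of q w is bounded away from 0,
    because pN is not an integer; hence q w is the only minimizer of F w
    (phi_lower_quantile). Since c ord_max 0 != 0, a point w of B^+ can be
    recovered from its other coordinates, so the K-minimizers include all
    pairs (w, q w) with w in B^+ (minimizer_quantile).

    By Minkowski's theorem (minkowski_cone) the epigraph cone is generated by
    finitely many (w_i, t_i, s_i). Normalizing the nonzero w_i by inner w_i c,
    which is positive as c is interior to C, every w in B^+ becomes a convex
    combination of normalized v_i with
      sum mu_i F (v_i) (q v_i) <= F w (q w)
    (Bplus_value_generators). The pairs (v_i, q v_i) therefore form a solution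
    (solution_exists).

    Every solution Tbar represents the cone quantile (solution_quantile). Fix z
    with t <= inner w z for all (w, t) in Tbar. The set of points lying above
    some D (w, t) with w in B^+ and t <= inner w z is convex and contains
    D [Tbar], hence D [T] + K. So for each w in B^+ there is
    t <= inner w z with F w t <= F w (q w), and uniqueness of the minimizer
    gives t = q w. *)

(** * Finitely generated cones *)

Section ConicHull.
Variables (R : realFieldType) (V : lmodType R).

Definition conic_hull (I : finType) (G : I -> V) : set V :=
  [set y | exists2 l : I -> R, (forall i, 0 <= l i) & y = \sum_i l i *: G i].

Definition finitely_generated (S : set V) :=
  exists (I : finType) (G : I -> V), S = conic_hull G.

Lemma sum_delta_gen (I : finType) (G : I -> V) i :
  \sum_j (j == i)%:R *: G j = G i.
Proof.
rewrite (bigD1 i) //= eqxx scale1r big1 ?addr0 // => j /negbTE ->.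
by rewrite scale0r.
Qed.

Lemma conic_hull_gen (I : finType) (G : I -> V) i : conic_hull G (G i).
Proof.
by exists (fun j => (j == i)%:R) => [j|]; rewrite ?ler0n ?sum_delta_gen.
Qed.

Lemma conic_hull_sub (I K : finType) (G : I -> V) (H : K -> V) :
  (forall k, conic_hull G (H k)) -> conic_hull H `<=` conic_hull G.
Proof.
move=> /(_ _)/cid2-/all_sig2[m m0 HE] _ [l l0 ->].
exists (fun i => \sum_k l k * m k i) => [i|].
  by apply: sumr_ge0 => k _; apply: mulr_ge0.
under eq_bigr => k _ do rewrite HE scaler_sumr.
rewrite exchange_big; apply: eq_bigr => i _; rewrite scaler_suml.
by apply: eq_bigr => k _; rewrite scalerA.
Qed.

Section ScalarForm.
Variables (a : V -> R) (lin_a : scalar a).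

Lemma scalar0 : a 0 = 0.
Proof. by have := lin_a (-1) 0 0; rewrite scaler0 addr0 mulN1r addNr. Qed.

Lemma scalarZ k u : a (k *: u) = k * a u.
Proof. by have := lin_a k u 0; rewrite scalar0 !addr0. Qed.

Lemma scalar_sum (I : finType) (l : I -> R) (G : I -> V) :
  a (\sum_i l i *: G i) = \sum_i l i * a (G i).
Proof.
elim/big_rec2: _ => [|i y1 y2 _ <-]; first exact: scalar0.
exact: lin_a.
Qed.

End ScalarForm.

Variables (I : finType) (G : I -> V) (a : V -> R).

(** The generators of the double description step: the old ones inside the
    half-space, and, for each pair on opposite sides of the hyperplane, a point
    of it between them, up to scaling. The generator 0 fills the remaining
    indices. *)
Definition halfspace_gen (k : I + I * I) : V :=
  match k with
  | inl i => if 0 <= a (G i) then G i else 0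
  | inr (i, j) => if (0 <= a (G i)) && (a (G j) < 0)
                  then a (G i) *: G j - a (G j) *: G i else 0
  end.

Hypothesis lin_a : scalar a.

(** Let S be the total of the weights l i * a (G i) over the generators inside
    the half-space P, and M the opposite of the total over those outside. A
    point with a y >= 0 has M <= S, and each outside generator is then
    compensated by the inside ones in proportion to their share of S. *)
Lemma conic_hull_halfspace :
  conic_hull G `&` [set y | 0 <= a y] = conic_hull halfspace_gen.
Proof.
apply/seteqP; split=> [y [[l l0 ->{y}]] /= | y yH]; last first.
  split=> /=.
    apply: conic_hull_sub yH => -[i|[i j]] /=; case: ifP => [|_].
    - by move=> _; apply: conic_hull_gen.
    - by exists (fun=> 0) => //; rewrite big1 // => k _; rewrite scale0r.
    - move=> /andP[ai aj].
      exists (fun k => a (G i) * (k == j)%:R - a (G j) * (k == i)%:R) => [k|].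
        rewrite -mulNr addr_ge0 // mulr_ge0 ?ler0n // oppr_ge0; exact: ltW.
      under eq_bigr => k _ do rewrite scalerBl -!scalerA.
      rewrite sumrB -!scaler_sumr.
      by rewrite !sum_delta_gen.
    - by exists (fun=> 0) => //; rewrite big1 // => k _; rewrite scale0r.
  case: yH => l l0 ->; rewrite (scalar_sum lin_a).
  apply: sumr_ge0 => k _; apply: mulr_ge0 => //.
  case: k => [i|[i j]] /=; first by case: ifP => // _; rewrite (scalar0 lin_a).
  case: ifP => _; last by rewrite (scalar0 lin_a).
  by rewrite addrC -scaleNr lin_a (scalarZ lin_a) mulNr mulrC addNr.
rewrite (scalar_sum lin_a) => sum_ge0.
pose P i := 0 <= a (G i).
pose S := \sum_(i | P i) l i * a (G i).
pose M := \sum_(i | ~~ P i) l i * - a (G i).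
have S0 : 0 <= S by apply: sumr_ge0 => i Pi; apply: mulr_ge0.
have MS : M <= S.
  rewrite -subr_ge0 /M; under eq_bigr do rewrite mulrN.
  by rewrite sumrN opprK; move: sum_ge0; rewrite (bigID P).
have NP i : ~~ P i = (a (G i) < 0) by rewrite /P -ltNge.
have Mt i : ~~ P i -> 0 <= l i * - a (G i).
  by rewrite NP => ai; rewrite mulr_ge0 // oppr_ge0 ltW.
have M0 : 0 <= M by apply: sumr_ge0 => i; apply: Mt.
have [S_eq0|S_neq0] := eqVneq S 0.
  (* Then M = 0 as well, so generators outside P have weight 0. *)
  exists (fun k => if k is inl i then l i else 0).
    by case.
  rewrite big_sumType /= [X in _ + X]big1 ?addr0; last by move=> k _; rewrite scale0r.
  apply: eq_bigr => i _; case: ifP => // /negbT nPi.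
  have /eqP : M = 0 by apply/eqP; rewrite eq_le M0 andbT -S_eq0.
  rewrite psumr_eq0 // => /allP /(_ i (mem_index_enum _)); rewrite -/(P i) nPi /=.
  rewrite mulf_eq0 oppr_eq0 => /orP[/eqP->|/eqP ai]; first by rewrite !scale0r.
  by move: nPi; rewrite ai lexx.
(* The pairs (i, j) use up the fraction M / S of the weight of G i. *)
exists (fun k => match k with inl i => l i * (1 - M / S)
                         | inr (i, j) => l i * l j / S end).
  case=> [i|[i j]]; last by rewrite divr_ge0 // mulr_ge0.
  by rewrite mulr_ge0 // subr_ge0 ler_pdivrMr ?mul1r // lt_def S_neq0.
rewrite big_sumType /=.
rewrite [X in _ + X](_ : _ = \sum_(i | P i) \sum_(j | ~~ P j)
   (l i * l j / S) *: (a (G i) *: G j - a (G j) *: G i)); last first.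
  rewrite [RHS]pair_big /= [LHS](bigID (fun k : I * I => P k.1 && ~~ P k.2)) /=.
  rewrite [X in _ + X]big1 ?addr0.
    by apply: eq_bigr => -[i j] /=; rewrite NP /P => ->.
  by move=> [i j] /=; rewrite NP /P => /negbTE ->; rewrite scaler0.
have eqP1 : \sum_(i | P i) \sum_(j | ~~ P j)
   (l i * l j / S) *: (a (G i) *: G j - a (G j) *: G i) =
   \sum_(j | ~~ P j) l j *: G j + \sum_(i | P i) (l i * (M / S)) *: G i.
  under eq_bigr => i _ do under eq_bigr => j _ do rewrite scalerBr.
  under eq_bigr => i _ do rewrite big_split /=.
  rewrite big_split /=; congr (_ + _).
    rewrite exchange_big /=; apply: eq_bigr => j _.
    under eq_bigr => i _ do rewrite scalerA.
    rewrite -scaler_suml; congr (_ *: _).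
    rewrite -[RHS]mulr1 -(divff S_neq0) {2}/S mulr_suml mulr_sumr.
    by apply: eq_bigr => i _; ring.
  apply: eq_bigr => i _.
  under eq_bigr => j _ do rewrite scalerA -scaleNr.
  rewrite -scaler_suml; congr (_ *: _).
  rewrite /M mulr_suml mulr_sumr; apply: eq_bigr => j _; ring.
rewrite eqP1 (bigID P) /= [X in _ = X + _](bigID P) /=.
rewrite [X in _ = _ + X + _]big1 ?addr0; last first.
  by move=> i /negbTE; rewrite /P => ->; rewrite scaler0.
rewrite addrCA addrC; congr (_ + _).
rewrite -big_split /=; apply: eq_bigr => i; rewrite /P => ->.
by rewrite -scalerDl; congr (_ *: _); ring.
Qed.

End ConicHull.

(** The whole space is generated by plus and minus a basis, and each inequality
    is one double description step. *)
Lemma minkowski_cone (R : realFieldType) (V : vectType R) (J : finType)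
    (a : J -> V -> R) (lin_a : forall j, scalar (a j)) :
  finitely_generated [set y | forall j, 0 <= a j y].
Proof.
suff fg (s : seq J) : finitely_generated [set y | all (fun j => 0 <= a j y) s].
  have [I [G GE]] := fg (enum J); exists I, G; rewrite -GE.
  apply/seteqP; split=> y /=; first by move=> aj; apply/allP.
  by move=> /allP aj j; apply: aj; rewrite mem_enum.
elim: s => [|j s [I [G GE]]].
  pose n := \dim (fullv : {vspace V}).
  pose b (i : 'I_n) : V := (vbasis (fullv : {vspace V}))`_i.
  exists (bool * 'I_n)%type, (fun k => if k.1 then b k.2 else - b k.2).
  apply/seteqP; split=> [y _|//].
  pose u i := coord (vbasis fullv) i y.
  exists (fun k => if k.1 then Num.max 0 (u k.2) else Num.max 0 (- u k.2)).
    by move=> [[] i] /=; rewrite le_max lexx.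
  rewrite [LHS](coord_vbasis (memvf y)).
  rewrite -(pair_bigA _ (fun k i => (if k then Num.max 0 (u i) else Num.max 0 (- u i))
    *: (if k then b i else - b i))) /=.
  rewrite big_bool /= -big_split /=; apply: eq_bigr => i _.
  rewrite -/(u i) -/(b i) scalerN -scalerBl; congr (_ *: _).
  by rewrite /Num.max; case: ltgtP => h; case: ltgtP => h'; lra.
exists (I + I * I)%type, (halfspace_gen G (a j)).
rewrite -conic_hull_halfspace // -GE.
by apply/seteqP; split=> y /=; [move=> /andP[]|move=> [-> ->]].
Qed.

(** * The quantile as unique minimizer of the check loss *)

Section CheckLoss.
Variables (R : realType) (N : nat).
Implicit Types (a b : 'I_N -> R) (p q r s t : R).

(** The added constant (1 - p) * \sum_i a i makes each summand a maximum of two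
    functions that are linear in (a, t). *)
Lemma phiE a p t : phi a p t = \sum_i Num.max (a i - p * t) ((1 - p) * t).
Proof.
rewrite /phi mulr_sumr -big_split /=; apply: eq_bigr => i _.
rewrite /pos_part /neg_part.
have [h|h] := leP t (a i).
  rewrite (max_r (y := a i - t)) ?(max_l (y := - _)) ?max_l; lra.
rewrite (max_l (y := a i - t)) ?(max_r (y := - _)) ?max_r; lra.
Qed.

Lemma phiZ a p r t : 0 <= r -> phi (fun i => r * a i) p (r * t) = r * phi a p t.
Proof.
move=> r0; rewrite !phiE mulr_sumr; apply: eq_bigr => i _.
by rewrite maxr_pMr // mulrBr !(mulrCA r).
Qed.

Lemma phiD a b p s t :
  phi (fun i => a i + b i) p (s + t) <= phi a p s + phi b p t.
Proof.
rewrite !phiE -big_split; apply: ler_sum => i _ /=.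
rewrite ge_max !mulrDr opprD addrACA !lerD //= le_max lexx ?orbT //.
Qed.

(** A sum of binary maxima is the maximum over all selections f, so the epigraph
    of phi is an intersection of finitely many half-spaces. *)
Lemma phi_le_iff a p s t :
  phi a p t <= s <->
  forall f : {ffun 'I_N -> bool},
    0 <= s - \sum_i (if f i then a i - p * t else (1 - p) * t).
Proof.
rewrite phiE; split=> [le_s f|].
  rewrite subr_ge0; apply: le_trans le_s; apply: ler_sum => i _.
  by rewrite le_max; case: (f i); rewrite lexx ?orbT.
move=> /(_ [ffun i => (1 - p) * t <= a i - p * t]); rewrite subr_ge0.
by apply: le_trans; apply: ler_sum => i _; rewrite ffunE /=; case: (leP ((1 - p) * t)).
Qed.

Variables (a : 'I_N -> R) (p : R).
Hypotheses (N_gt0 : (0 < N)%N) (p01 : 0 < p < 1).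
Hypothesis pN_nint : p * N%:R \isn't a Num.int.

(** As pN is not an integer, the inequality defining the quantile is strict. If
    at least pN data were below q, the largest of these would already satisfy
    that inequality, against minimality of q. *)
Lemma lower_quantile_count (q := lower_quantile a p) :
  #|[pred i | a i < q]|%:R < p * N%:R < #|[pred i | a i <= q]|%:R.
Proof.
have pN0 : 0 < p * N%:R by case/andP: p01 => p0 _; rewrite mulr_gt0 ?ltr0n.
pose A := [set v | range a v /\
  Num.ceil (N%:R * p) <= (#|[pred i | a i <= v]|)%:Z].
have ltpN n : (Num.ceil (N%:R * p) <= n%:Z) = (p * N%:R < n%:R).
  rewrite ceil_le_int mulrC le_eqVlt; case: eqVneq => // eq_n.
  by move: pN_nint; rewrite eq_n natr_int.
have [m Am minm] : exists2 m, A m & lbound A m.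
  pose good i := Num.ceil (N%:R * p) <= (#|[pred j | a j <= a i]|)%:Z.
  have [imax _ max_imax] := @arg_maxP _ _ _ (Ordinal N_gt0) predT a isT.
  have good_max : good imax.
    rewrite /good ltpN (eq_card (B := predT)) => [|j]; last first.
      by rewrite !inE; apply: (max_imax j isT).
    by rewrite card_ord gtr_pMl ?ltr0n //; case/andP: p01.
  have [imin gmin min_imin] := @arg_minP _ _ _ imax good a good_max.
  exists (a imin); first by split=> //; exists imin.
  by move=> _ [[i _ <-] gi]; apply: min_imin.
have [Aq minq] : A q /\ lbound A q.
  by apply: (@xgetPex _ 0 [set m | A m /\ lbound A m]); exists m.
case: (Aq) => _; rewrite ltpN => ->; rewrite andbT ltNge; apply/negP => le_pN.
have : (0 < #|[pred i | (a i < q)%R]|)%N.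
  by rewrite -(ltr0n R); apply: lt_le_trans le_pN.
case/card_gt0P => i0 lt_i0.
have [i lt_iq max_i] := @arg_maxP _ _ _ i0 [pred i | a i < q] a lt_i0.
rewrite /= in lt_iq.
suff Ai : A (a i) by have := minq _ Ai; rewrite leNgt lt_iq.
split; first by exists i.
rewrite ceil_le_int mulrC; apply: le_trans le_pN _.
rewrite ler_nat; apply: subset_leq_card; apply/fintype.subsetP => j.
exact: max_i.
Qed.

(** Compare the maxima termwise, using for t the branch that is active at q:
    the increment is at least |t - q| times |#{a i < q} - pN| or
    |#{a i <= q} - pN|, according to the side of t. *)
Lemma phi_lower_quantile t (q := lower_quantile a p) :
  t != q -> phi a p q < phi a p t.
Proof.
have /andP[ltN gtN] := lower_quantile_count.
rewrite -subr_gt0 !phiE -sumrB => tq.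
pose w i := (if t < q then (q - t) * (p - (a i < q)%R%:R)
                      else (t - q) * ((a i <= q)%R%:R - p)).
apply: (@lt_le_trans _ _ (\sum_i w i)); last first.
  apply: ler_sum => i _; rewrite /w.
  case/andP: p01 => p0 p1.
  have pq : (q - t) * p = p * q - p * t by ring.
  case: ltgtP tq => // tq _.
    have [aq|aq] := ltP (a i) q.
      rewrite [X in _ <= _ - X]max_r; last lra.
      have : (1 - p) * t <= Num.max (a i - p * t) ((1 - p) * t).
        by rewrite le_max lexx orbT.
      rewrite mulrBr mulr1 pq; lra.
    rewrite [X in _ <= _ - X]max_l; last lra.
    have : a i - p * t <= Num.max (a i - p * t) ((1 - p) * t).
      by rewrite le_max lexx.
    rewrite subr0 pq; lra.
  have [aq|aq] := leP (a i) q.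
    rewrite [X in _ <= _ - X]max_r; last lra.
    have : (1 - p) * t <= Num.max (a i - p * t) ((1 - p) * t).
      by rewrite le_max lexx orbT.
    rewrite /=; lra.
  rewrite [X in _ <= _ - X]max_l; last lra.
  have : a i - p * t <= Num.max (a i - p * t) ((1 - p) * t).
    by rewrite le_max lexx.
  rewrite /=; lra.
have cardE (P : pred 'I_N) : \sum_i (P i)%:R = #|P|%:R :> R.
  rewrite -sum1_card natr_sum [RHS]big_mkcond; apply: eq_bigr => i _.
  by rewrite -topredE /=; case: (P i).
rewrite /w; case: (ltgtP t q) tq => // tq _; rewrite -mulr_sumr mulr_gt0 ?subr_gt0 //.
  rewrite sumrB (cardE [pred i | a i < q]) sumr_const card_ord subr_gt0.
  by rewrite -(mulr_natr p).
rewrite sumrB (cardE [pred i | a i <= q]) sumr_const card_ord subr_gt0.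
by rewrite -(mulr_natr p).
Qed.

End CheckLoss.

(** * Convex sets *)

Section Convex.
Variables (R : realType) (V : lmodType R).

Lemma convex_setP (A : set V) :
  convex_set A <->
  forall u v (k : R), 0 <= k -> k <= 1 -> A u -> A v ->
    A (k *: u + (1 - k) *: v).
Proof.
split=> [cA u v k k0 k1 Au Av|cA u v k]; last first.
  by rewrite !inE => Au Av; apply: cA.
by have := cA u v (Itv01 k0 k1); rewrite !inE; apply.
Qed.

Lemma conv_hull_convex (S : set V) : convex_set (conv_hull S).
Proof.
apply/convex_setP => u v k k0 k1 hu hv B [cB SB].
by apply: ((convex_setP B).1 cB) => //; [exact: hu|exact: hv].
Qed.

(** The points f i with weight 0 need not lie in A: this lets a family of
    generators contain degenerate members. *)
Lemma convex_set_sum (A : set V) (I : finType) (mu : I -> R) (f : I -> V) :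
  convex_set A -> (forall i, 0 <= mu i) -> (forall i, 0 < mu i -> A (f i)) ->
  \sum_i mu i = 1 -> A (\sum_i mu i *: f i).
Proof.
move=> /convex_setP cA mu0 Af sum1.
pose s := index_enum I.
(* Partial sums are renormalized by their total weight, unless it is 0. *)
suff : (\sum_(i <- s) mu i = 0 /\ \sum_(i <- s) mu i *: f i = 0) \/
    (0 < \sum_(i <- s) mu i /\
     A ((\sum_(i <- s) mu i)^-1 *: \sum_(i <- s) mu i *: f i)).
  rewrite sum1 => -[[/eqP]|[_]]; first by rewrite oner_eq0.
  by rewrite invr1 scale1r.
elim: s => [|i s]; first by left; rewrite !big_nil.
rewrite !big_cons; set S := \sum_(_ <- _) _; set F := \sum_(_ <- _) _ *: _.
have [->|mu_neq0] := eqVneq (mu i) 0; first by rewrite scale0r !add0r.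
have mui : 0 < mu i by rewrite lt_def mu_neq0 mu0.
case=> [[-> ->]|[S0 AF]]; right; rewrite ?addr0.
  by split=> //; rewrite scalerA mulVf // scale1r; apply: Af.
have T0 : 0 < mu i + S by apply: addr_gt0.
split=> //.
have k0 : 0 <= mu i / (mu i + S) by rewrite divr_ge0 // ltW.
have k1 : mu i / (mu i + S) <= 1 by rewrite ler_pdivrMr // mul1r lerDl ltW.
have := cA _ _ _ k0 k1 (Af _ mui) AF.
have -> : 1 - mu i / (mu i + S) = S / (mu i + S).
  by rewrite -[1](divff (lt0r_neq0 T0)) -mulrBl addrC addKr.
by rewrite scalerA mulrAC divff ?lt0r_neq0 // mul1r mulrC -scalerA -scalerDr.
Qed.

End Convex.

(** * Dual cones *)

Section DualCone.
Variables (R : realType) (d : nat).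
Implicit Types (C : set 'cV[R]_d) (u w z c : 'cV[R]_d).

Lemma innerE w z : inner w z = \sum_i w i 0 * z i 0.
Proof. by rewrite /inner mxE; apply: eq_bigr => i _; rewrite mxE. Qed.

Lemma innerC w z : inner w z = inner z w.
Proof. by rewrite !innerE; apply: eq_bigr => i _; rewrite mulrC. Qed.

Lemma inner_scalar w : scalar (inner w).
Proof.
move=> k u v; rewrite !innerE mulr_sumr -big_split; apply: eq_bigr => i _.
by rewrite !mxE mulrDr mulrCA.
Qed.

Lemma innerZ k w z : inner (k *: w) z = k * inner w z.
Proof. by rewrite innerC (scalarZ (inner_scalar z)) innerC. Qed.

Lemma innerD w u z : inner (w + u) z = inner w z + inner u z.
Proof.
by rewrite innerC -[w]scale1r inner_scalar mul1r scale1r !(innerC z).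
Qed.

Lemma inner_suml (I : finType) (l : I -> R) (W : I -> 'cV[R]_d) z :
  inner (\sum_i l i *: W i) z = \sum_i l i * inner (W i) z.
Proof.
rewrite innerC (scalar_sum (inner_scalar z)).
by apply: eq_bigr => i _; rewrite innerC.
Qed.

(** A cone described by affine inequalities satisfies the homogeneous ones:
    otherwise a large multiple of a point would leave it. *)
Lemma polyhedral_cone_halfspaces C :
  polyhedral C -> is_cone C -> C !=set0 ->
  exists (m : nat) (A : 'M[R]_(m, d)),
    C = [set y | forall i, 0 <= (A *m y) i 0].
Proof.
move=> [m [A [b CE]]] coneC [y0 Cy0].
have b_le0 i : b i 0 <= 0.
  have := coneC 0 y0 (lexx 0) Cy0; rewrite scale0r CE => /(_ i).
  by rewrite mulmx0 mxE.
exists m, A; apply/seteqP; split=> y /=; last first.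
  by move=> Ay; rewrite CE => i; apply: le_trans (b_le0 i) (Ay i).
move=> Cy i; rewrite leNgt; apply/negP => neg.
(* This multiple of y has the value b i 0 - 1 in row i. *)
pose s := (1 - b i 0) / - (A *m y) i 0.
have s0 : 0 <= s.
  rewrite divr_ge0 // ?subr_ge0 ?oppr_ge0; last exact: ltW.
  exact: le_trans (b_le0 i) ler01.
have := coneC s y s0 Cy; rewrite CE => /(_ i).
rewrite -scalemxAr mxE /s invrN mulrN mulNr divfK ?lt_eqF //; lra.
Qed.

(** The inequalities are given by the generators of C. *)
Lemma dual_cone_halfspaces C : polyhedral_convex_cone C -> C !=set0 ->
  exists (I : finType) (G : I -> 'cV[R]_d),
    dual_cone C = [set w | forall i, 0 <= inner w (G i)].
Proof.
move=> [polyC _ coneC] C_neq0.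
have [m [A CE]] := polyhedral_cone_halfspaces polyC coneC C_neq0.
have lin_A (i : 'I_m) : scalar (fun y : 'cV[R]_d => (A *m y) i 0).
  by move=> k u v; rewrite mulmxDr -scalemxAr !mxE.
have [I [G GE]] := minkowski_cone lin_A.
exists I, G; apply/seteqP; split=> w /=.
  move=> Cw i; apply: Cw; rewrite CE GE; exact: conic_hull_gen.
move=> wG y; rewrite CE GE => -[l l0 ->].
by rewrite (scalar_sum (inner_scalar w)) sumr_ge0 // => i _; rewrite mulr_ge0.
Qed.

(** For small k > 0 the point c - k w is still in C, so
    inner w c >= k * inner w w > 0. *)
Lemma inner_interior_gt0 C c w :
  C° c -> dual_cone C w -> w != 0 -> 0 < inner w c.
Proof.
move=> /nbhs_ballP[e /= e0 ballC] Cw w_neq0.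
pose k := e / (2 * (`|w| + 1)).
have k0 : 0 < k by rewrite divr_gt0 // mulr_gt0 // ltr_wpDl.
have : C (c - k *: w).
  apply: ballC; rewrite -ball_normE /= opprB addrC subrK normrZ gtr0_norm //.
  rewrite /k mulrAC ltr_pdivrMr ?mulr_gt0 ?ltr_wpDl // ltr_pM2l //.
  have := normr_ge0 w; lra.
move=> /Cw; rewrite addrC -scaleNr inner_scalar mulNr => h.
suff : 0 < inner w w by move=> ww; have := mulr_gt0 k0 ww; lra.
have ge0 (i : 'I_d) : true -> 0 <= w i 0 * w i 0 by rewrite -expr2 sqr_ge0.
rewrite innerE lt_def sumr_ge0 // andbT; apply: contra w_neq0.
rewrite psumr_eq0 // => /allP w0; apply/eqP/matrixP => i j.
by have := w0 i (mem_index_enum _); rewrite ord1 mxE mulf_eq0 orbb => /eqP.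
Qed.

End DualCone.

(** * The quantile program *)

Section QuantileProgramSolution.
Variables (R : realType) (d N : nat) (x : 'I_N -> 'cV[R]_d.+1) (p : R).
Variables (C : set 'cV[R]_d.+1) (c : 'cV[R]_d.+1).
Hypotheses (N_gt0 : (0 < N)%N) (p01 : 0 < p < 1).
Hypothesis pN_nint : p * N%:R \isn't a Num.int.
Hypotheses (coneC : polyhedral_convex_cone C) (int_c : C° c).
Hypothesis cd_neq0 : c ord_max 0 != 0.

Implicit Types (w z y : 'cV[R]_d.+1) (t : R).

Let F w t : R := phi (fun i => inner w (x i)) p t.
Let q w : R := lower_quantile (fun i => inner w (x i)) p.
Let K := @last_axis_cone R d.
Let D := objective x p c.
Let sigma : R := c ord_max 0 / `|c ord_max 0|.

Let FZ r w t : 0 <= r -> F (r *: w) (r * t) = r * F w t.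
Proof.
move=> r0; rewrite /F -phiZ //; congr phi.
by apply: funext => i; rewrite innerZ.
Qed.

Let FD w1 w2 t1 t2 : F (w1 + w2) (t1 + t2) <= F w1 t1 + F w2 t2.
Proof.
rewrite /F; apply: le_trans (phiD _ _ _ _ _); rewrite le_eqVlt.
apply/orP; left; apply/eqP; congr phi.
by apply: funext => i; rewrite innerD.
Qed.

Let F_min w t : F w (q w) <= F w t.
Proof.
have [->//|tq] := eqVneq t (q w).
by apply: ltW; apply: phi_lower_quantile.
Qed.

Let F_argmin w t : F w t <= F w (q w) -> t = q w.
Proof.
move=> Fle; apply/eqP; apply: contraTT Fle => tq.
by rewrite -ltNge; apply: phi_lower_quantile.
Qed.

Let F0_ge0 t : 0 <= F 0 t.
Proof.
rewrite /F phiE; apply: sumr_ge0 => i _.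
rewrite -[0 : 'cV_ _](scale0r 0) innerZ mul0r le_max sub0r oppr_ge0.
case/andP: p01 => p0 p1; case: (leP 0 t) => t0.
  by rewrite (mulr_ge0 _ t0) ?orbT // subr_ge0 ltW.
by rewrite pmulr_rle0 // ltW.
Qed.

Let cC : C c. Proof. exact: interior_subset. Qed.

(** The value function w |-> F w (q w) is polyhedral on the dual cone: the W i
    are the first components of generators of the epigraph cone of F, whose
    last components dominate the values at W i. *)
Lemma value_generators :
  exists (I : finType) (W : I -> 'cV[R]_d.+1),
    (forall i, dual_cone C (W i)) /\
    forall w, dual_cone C w -> exists l : I -> R,
      [/\ forall i, 0 <= l i, w = \sum_i l i *: W i &
          \sum_i l i * F (W i) (q (W i)) <= F w (q w)].
Proof.
have [J [G dualE]] : exists (J : finType) (G : J -> 'cV[R]_d.+1),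
    dual_cone C = [set w | forall i, 0 <= inner w (G i)].
  by apply: dual_cone_halfspaces => //; exists c.
pose V := ('cV[R]_d.+1 * (R^o * R^o))%type.
pose form (k : J + {ffun 'I_N -> bool}) (v : V) : R :=
  match k with
  | inl j => inner v.1 (G j)
  | inr f => v.2.2 - \sum_i (if f i then inner v.1 (x i) - p * v.2.1
                             else (1 - p) * v.2.1)
  end.
have lin_form k : scalar (form k).
  move=> r u v; case: k => [j|f] /=; first by rewrite innerD innerZ.
  rewrite mulrBr mulr_sumr addrACA -opprD -big_split; congr (_ - _).
  apply: eq_bigr => i _; rewrite /= innerD innerZ /GRing.scale /=.
  by case: (f i); ring.
have [I [g gE]] := minkowski_cone lin_form.
have epiE (v : V) : (dual_cone C v.1 /\ F v.1 v.2.1 <= v.2.2) <-> conic_hull g v.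
  rewrite -gE dualE /=; split=> [[vG Fv] [j|f]|h]; first exact: vG.
    by move/phi_le_iff : Fv; apply.
  split=> [j|]; first exact: (h (inl j)).
  by apply/phi_le_iff => f; apply: (h (inr f)).
have gP i := (epiE (g i)).2 (conic_hull_gen g i).
exists I, (fun i => (g i).1); split=> [i|w Cw]; first by case: (gP i).
have : conic_hull g ((w, (q w, F w (q w))) : V) by apply/epiE.
move=> [l l0 E]; exists l; split=> //.
  rewrite -[LHS]/((w, (q w, F w (q w))) : V).1 E.
  exact: (raddf_sum (@fst _ _)).
rewrite -[leRHS]/((w, (q w, F w (q w))) : V).2.2 E.
rewrite (raddf_sum (@snd _ _)) (raddf_sum (@snd _ _)).
apply: ler_sum => i _; apply: ler_wpM2l => //.
by apply: le_trans (F_min _ _) (gP i).2.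
Qed.

(** Scaling W i into B^+ multiplies its weight by inner (W i) c. Generators
    with W i = 0 cannot be scaled; they get weight 0, and dropping them only
    decreases the left-hand side as F 0 t >= 0. *)
Lemma Bplus_value_generators :
  exists (I : finType) (v : I -> 'cV[R]_d.+1),
    forall w, Bplus C c w -> exists mu : I -> R,
      [/\ forall i, 0 <= mu i, forall i, 0 < mu i -> Bplus C c (v i),
          \sum_i mu i = 1, w = \sum_i mu i *: v i &
          \sum_i mu i * F (v i) (q (v i)) <= F w (q w)].
Proof.
have [I [W [CW gen]]] := value_generators.
have W0 i : inner (W i) c <= 0 -> W i = 0.
  move=> le0; apply/eqP; apply: contraTT le0 => W0.
  by rewrite -ltNge; apply: inner_interior_gt0 int_c _ _.
have W_ge0 i : 0 <= inner (W i) c by apply: CW.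
exists I, (fun i => (inner (W i) c)^-1 *: W i) => w [Cw wc].
have [l [l0 wE lF]] := gen w Cw.
exists (fun i => l i * inner (W i) c); split=> [i|i||  |].
- exact: mulr_ge0.
- move=> mu0; have Wi : inner (W i) c != 0.
    by apply: contraTneq mu0 => ->; rewrite mulr0 ltxx.
  split; last by rewrite /= innerZ mulVf.
  by move=> y Cy; rewrite innerZ mulr_ge0 ?invr_ge0 //; apply: CW.
- by rewrite -wc [in RHS]wE inner_suml.
- rewrite [LHS]wE; apply: eq_bigr => i _; rewrite scalerA.
  have [Wi|Wi] := eqVneq (inner (W i) c) 0; last by rewrite mulfK.
  by rewrite (W0 i) ?Wi // !scaler0.
apply: le_trans lF; apply: ler_sum => i _; rewrite -mulrA ler_wpM2l //.
have [Wi|Wi] := eqVneq (inner (W i) c) 0.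
  by rewrite Wi mul0r (W0 i) ?Wi // F0_ge0.
(* F is positively homogeneous, so scaling q (W i) along with W i gives a
   competitor for the minimum at the scaled point. *)
have r0 : 0 < inner (W i) c by rewrite lt_def Wi W_ge0.
rewrite mulrC -ler_pdivlMr // mulrC.
by rewrite -FZ ?invr_ge0 //; apply: F_min.
Qed.

Let D_last w t : D (w, t) ord_max 0 = F w t.
Proof. by rewrite mxE eqxx. Qed.

Let D_other w t i : i != ord_max -> D (w, t) i 0 = sigma * w i 0.
Proof. by move=> /negbTE im; rewrite mxE im. Qed.

Let sigma_neq0 : sigma != 0.
Proof. by rewrite mulf_neq0 // invr_eq0 normr_eq0. Qed.

(** The equation inner w c = 1 determines the last coordinate. *)
Lemma Bplus_eq w1 w2 : Bplus C c w1 -> Bplus C c w2 ->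
  (forall i, i != ord_max -> w1 i 0 = w2 i 0) -> w1 = w2.
Proof.
move=> [_ /= w1c] [_ /= w2c] eq_w.
suff eq_last : w1 ord_max 0 = w2 ord_max 0.
  apply/matrixP => i j; rewrite ord1.
  by have [->|im] := eqVneq i ord_max; [|apply: eq_w].
apply: (mulIf cd_neq0); move: w1c; rewrite -{}w2c !innerE.
rewrite (bigD1 ord_max) //= [in RHS](bigD1 ord_max) //=.
rewrite (eq_bigr (fun i => w2 i 0 * c i 0)) => [/addIr //|i im].
by rewrite eq_w.
Qed.

Lemma minimizer_quantile w : Bplus C c w ->
  minimizer K D (feasible C c) (w, q w).
Proof.
move=> Bw; split=> //; split; first by exists (w, q w).
move=> _ [[w' t] [/= Bw' _] <-] [eq_other].
rewrite mxE [X in _ + X]mxE !D_last subr_ge0 => Fle.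
have ww' : w = w'.
  apply: Bplus_eq => // i im; have := eq_other i im.
  rewrite mxE [X in _ + X]mxE !D_other // -mulrBr => /eqP.
  by rewrite mulf_eq0 (negbTE sigma_neq0) subr_eq0 => /eqP.
by rewrite -ww' in Fle *; rewrite (F_argmin Fle).
Qed.

(** The points above the image of P, written without the sum with K. *)
Definition upper_image (P : set ('cV[R]_d.+1 * R)) : set 'cV[R]_d.+1 :=
  [set y | exists w t, [/\ P (w, t),
     forall i, i != ord_max -> y i 0 = sigma * w i 0 & F w t <= y ord_max 0]].

Lemma upper_imageE P : minkowski_sum (D @` P) K = upper_image P.
Proof.
apply/seteqP; split=> [_ [_ [[w t] Pwt <-] [k [k_other k0] <-]]|y].
  exists w, t; split=> // [i im|].
    by rewrite mxE D_other // k_other // addr0.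
  by rewrite mxE D_last lerDl.
move=> [w [t [Pwt y_other Fy]]].
exists (D (w, t)); first by exists (w, t).
exists (y - D (w, t)); last by rewrite addrC subrK.
split=> [i im|]; rewrite mxE [X in _ + X]mxE.
  by rewrite D_other // y_other // subrr.
by rewrite D_last subr_ge0.
Qed.

(** This is the joint convexity of F in (w, t). *)
Lemma upper_image_convex (P : set ('cV[R]_d.+1 * R)) :
  (forall w1 w2 t1 t2 (k : R), 0 <= k -> k <= 1 -> P (w1, t1) -> P (w2, t2) ->
     P (k *: w1 + (1 - k) *: w2, k * t1 + (1 - k) * t2)) ->
  @convex_set R 'cV[R]_d.+1 (upper_image P).
Proof.
move=> convP; apply/convex_setP => y1 y2 k k0 k1.
move=> [w1 [t1 [P1 y1o F1]]] [w2 [t2 [P2 y2o F2]]].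
exists (k *: w1 + (1 - k) *: w2), (k * t1 + (1 - k) * t2); split.
- exact: convP.
- by move=> i im; rewrite !mxE y1o // y2o //; ring.
have k1' : 0 <= 1 - k by rewrite subr_ge0.
rewrite !mxE; apply: le_trans (FD _ _ _ _) _; rewrite !FZ //.
by apply: lerD; apply: ler_wpM2l.
Qed.

Let Bplus_convex w1 w2 (k : R) : 0 <= k -> k <= 1 ->
  Bplus C c w1 -> Bplus C c w2 -> Bplus C c (k *: w1 + (1 - k) *: w2).
Proof.
move=> k0 k1 [C1 c1] [C2 c2]; rewrite /= in c1 c2.
split=> [y Cy|]; rewrite /= innerD !innerZ; last by rewrite c1 c2; ring.
by rewrite addr_ge0 // mulr_ge0 ?subr_ge0 //; [apply: C1|apply: C2].
Qed.

Lemma conv_hull_upper_image (A : set 'cV[R]_d.+1) P :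
  @convex_set R 'cV[R]_d.+1 (upper_image P) -> A `<=` upper_image P ->
  minkowski_sum (conv_hull A) K `<=` upper_image P.
Proof.
move=> convP AP _ [y Ay [k [k_other k0] <-]].
have [w [t [Pwt y_other Fy]]] : upper_image P y.
  exact: (smallest_sub convP AP).
exists w, t; split=> // [i im|]; rewrite mxE.
  by rewrite k_other // addr0 y_other.
by apply: le_trans Fy _; rewrite lerDl.
Qed.

Lemma solution_exists :
  exists Tbar, solution K D (feasible C c) Tbar.
Proof.
have [I [v gen]] := Bplus_value_generators.
pose Tbar := feasible C c `&` range (fun i => (v i, q (v i))).
have subT : Tbar `<=` feasible C c by move=> u [].
exists Tbar; split=> //.
- apply: (@sub_finite_set _ _ (range (fun i => (v i, q (v i))))) => [u []|] //.
  by apply: finite_image; apply: finite_finset.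
- by move=> u [[Bu _] [i _ vE]]; rewrite -vE in Bu *; apply: minimizer_quantile.
apply/seteqP; split; last first.
  rewrite [X in _ `<=` X]upper_imageE; apply: conv_hull_upper_image.
    apply: upper_image_convex => w1 w2 t1 t2 k k0 k1 [B1 _] [B2 _].
    by split=> //; apply: Bplus_convex.
  move=> _ [[w t] Twt <-]; exists w, t; split=> //; first exact: subT.
    by move=> i; apply: D_other.
  by rewrite D_last.
rewrite upper_imageE => y [w [t [[/= Bw _] y_other Fy]]].
have [mu [mu0 muB mu1 wE muF]] := gen w Bw.
pose y0 := \sum_i mu i *: D (v i, q (v i)).
exists y0.
  apply: convex_set_sum => //; last first.
    move=> i /muB Bv; apply: sub_gen_smallest.
    by exists (v i, q (v i)) => //; split=> //; exists i.
  exact: conv_hull_convex.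
exists (y - y0); last by rewrite addrC subrK.
have y0E i : y0 i 0 = \sum_j mu j * D (v j, q (v j)) i 0.
  by rewrite summxE; apply: eq_bigr => j _; rewrite mxE.
split=> [i im|]; rewrite mxE [X in _ + X]mxE y0E.
  rewrite y_other // wE summxE mulr_sumr -sumrB big1 // => j _.
  by rewrite mxE D_other //; ring.
rewrite subr_ge0; apply: le_trans Fy; apply: le_trans (F_min w t).
by apply: le_trans muF; apply: ler_sum => i _; rewrite D_last.
Qed.

Lemma solution_quantile Tbar : solution K D (feasible C c) Tbar ->
  cone_quantile x C c p = \bigcap_(wt in Tbar) [set z | wt.2 <= inner wt.1 z].
Proof.
move=> [_ subT minT sumE]; apply/seteqP; split=> z /= zQ.
  move=> [w t] Twt /=; have [/= Bw _] := subT _ Twt.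
  suff -> : t = q w by apply: zQ.
  have [_ [_ /(_ (D (w, q w)))]] := minT _ Twt.
  have Dq : (D @` feasible C c) (D (w, q w)) by exists (w, q w).
  move=> /(_ Dq) h; apply: F_argmin; rewrite -!D_last h //.
  split=> [i im|]; rewrite mxE [X in _ + X]mxE; first by rewrite !D_other // subrr.
  by rewrite !D_last subr_ge0; apply: F_min.
move=> w Bw /=.
pose P := [set wt | Bplus C c wt.1 /\ wt.2 <= inner wt.1 z].
have convP : @convex_set R 'cV[R]_d.+1 (upper_image P).
  apply: upper_image_convex => w1 w2 t1 t2 k k0 k1 [/= B1 le1] [/= B2 le2].
  split=> /=; first exact: Bplus_convex.
  by rewrite innerD !innerZ lerD // ler_wpM2l // subr_ge0.
have sub : D @` Tbar `<=` upper_image P.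
  move=> _ [[w' t] Twt <-]; exists w', t; split=> [|i|].
  - by have [/= Bw' _] := subT _ Twt; split=> //; apply: (zQ (w', t)).
  - exact: D_other.
  - by rewrite D_last.
(* D (w, q w) lies in D [T] + K, hence above the image of P. *)
have [w' [t [[/= Bw' tz] D_w Fle]]] : upper_image P (D (w, q w)).
  apply: conv_hull_upper_image sub _ _ => //.
  rewrite -sumE upper_imageE; exists w, (q w); split=> // [i|].
    exact: D_other.
  by rewrite D_last.
have ww' : w = w'.
  apply: Bplus_eq => // i im; have := D_w i im; rewrite D_other //.
  exact: mulfI.
by rewrite -ww' D_last in Fle tz; move: tz; rewrite (F_argmin Fle).
Qed.

End QuantileProgramSolution.

Theorem mainTheorem1 (R : realType) (d N : nat) (hN : (0 < N)%N)
    (x : 'I_N -> 'cV[R]_d.+1) (p : R) (hp : 0 < p < 1)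
    (hpN : p * N%:R \isn't a Num.int)
    (C : set 'cV[R]_d.+1) (hC : polyhedral_convex_cone C) (hline : line_free C)
    (c : 'cV[R]_d.+1) (hc : C° c) (hcd : c ord_max 0 != 0) :
  exists Tbar : set ('cV[R]_d.+1 * R),
    solution (@last_axis_cone R d) (objective x p c) (feasible C c) Tbar /\
    cone_quantile x C c p =
      \bigcap_(wt in Tbar) [set z | wt.2 <= inner wt.1 z].
Proof.
have [Tbar solT] := solution_exists x hN hp hpN hC hc hcd.
exists Tbar; split=> //.
exact: solution_quantile hN hp hpN hcd Tbar solT.
Qed.
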